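(* Let $P$ be a set of $n\geq 5$ points in general position in the plane. Then $\mu(D(P))\geq \binom{n}{2}-9$.
   Context: A set of points in the plane is in general position if no three of its points are collinear. The disjointness graph of segments $D(P)$ is the graph whose vertices are all closed straight-line segments with both endpoints in $P$, two being adjacent if and only if they are disjoint. For a graph $G$ and $U\subseteq V(G)$, two distinct vertices $x,y\in U$ are $U$-mutually visible if $G$ contains a shortest $x$-$y$ path none of whose internal vertices lies in $U$; $U$ is a mutual-visibility set if every two distinct vertices of $U$ are $U$-mutually visible. The mutual-visibility number $\mu(G)$ is the maximum size of a mutual-visibility set of $G$. *)

(* Defs.v *)
From HB Require Import structures.
From mathcomp Require Import all_boot all_order all_algebra.
From mathcomp Require Import boolp reals.
Set Implicit Arguments. Unset Strict Implicit. Unset Printing Implicit Defensive.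
Import Order.TTheory GRing.Theory Num.Theory.
Local Open Scope ring_scope.

Section Defs.
Variable R : realType.

Definition point := (R * R)%type.

Definition collinear (a b c : point) : Prop :=
  (b.1 - a.1) * (c.2 - a.2) - (b.2 - a.2) * (c.1 - a.1) = 0.

Definition general_position (n : nat) (p : 'I_n -> point) : Prop :=
  injective p /\
  forall i j k : 'I_n, i != j -> j != k -> i != k -> ~ collinear (p i) (p j) (p k).

Definition on_closed_segment (a b z : point) : Prop :=
  exists t : R, 0 <= t /\ t <= 1 /\
    z = (a.1 + t * (b.1 - a.1), a.2 + t * (b.2 - a.2)).

Definition segment (n : nat) := {e : {set 'I_n} | #|e| == 2%N}.

Definition seg_points (n : nat) (p : 'I_n -> point) (e : segment n) (z : point) : Prop :=
  exists i j : 'I_n, [/\ i \in val e, j \in val e, i != j & on_closed_segment (p i) (p j) z].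

Definition D_adj (n : nat) (p : 'I_n -> point) (e f : segment n) : Prop :=
  ~ exists z : point, seg_points p e z /\ seg_points p f z.

End Defs.

Section Graphs.
Variables (V : finType) (adj : V -> V -> Prop).

Fixpoint is_walk (x : V) (s : seq V) : Prop :=
  match s with
  | [::] => True
  | y :: s' => adj x y /\ is_walk y s'
  end.

(* s describes an x-y walk x, s_1, ..., s_k = y of length k = size s *)
Definition xy_walk (x y : V) (s : seq V) : Prop := is_walk x s /\ last x s = y.

Definition shortest_path (x y : V) (s : seq V) : Prop :=
  xy_walk x y s /\ forall s' : seq V, xy_walk x y s' -> (size s <= size s')%N.

Definition internal (x : V) (s : seq V) : seq V := behead (belast x s).

Definition mutually_visible (U : {set V}) (x y : V) : Prop :=
  exists s : seq V, shortest_path x y s /\ forall v, v \in internal x s -> v \notin U.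

Definition mutual_visibility_set (U : {set V}) : Prop :=
  forall x y : V, x \in U -> y \in U -> x != y -> mutually_visible U x y.

Definition mu : nat := \max_(U : {set V} | `[< mutual_visibility_set U >]) #|U|.

End Graphs.

(* Main.v *)
(** If [W] is a set of at most 9 segments such that any two intersecting segments
    outside [W] have a common neighbour in [W], then the complement of [W] is a
    mutual-visibility set.  To find [W], take the lexicographically smallest
    point [A], sort the other points by angle around [A], and keep only [A], the
    first four and the last three points (all points when n <= 7).  Every other
    point lies in the angular gap between the two groups, so a segment with such
    an end behaves in one of finitely many ways towards the segments of the kept
    points.  A suitable [W] among these depends only on the orientations of the
    triples of kept points; a decision tree on these orientations selects it, and
    the tree is checked by computation.  For n = 7 there are pairs of segments
    without any common neighbour, which are joined by a path of length 3 with
    its interior in [W]. *)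
Require Import Defs.
From HB Require Import structures.
From mathcomp Require Import all_boot all_order all_algebra.
From mathcomp Require Import boolp reals ring lra zify.
Set Implicit Arguments. Unset Strict Implicit. Unset Printing Implicit Defensive.
Import Order.TTheory GRing.Theory Num.Theory.

(** * Visibility and plane segments *)

Section Graph.
Variables (V : finType) (adj : V -> V -> Prop).

Lemma leq_mu (U : {set V}) : mutual_visibility_set adj U -> #|U| <= mu adj.
Proof.
by move=> UP; apply: (@leq_bigmax_cond _ _ (fun U : {set V} => #|U|)); apply/asboolP.
Qed.

Lemma leq_mu_of_links (W : {set V}) :
  (forall x y, x \notin W -> y \notin W -> x != y ->
    [\/ adj x y,
        exists2 w, w \in W & adj x w /\ adj w y
      | (forall z, ~ (adj x z /\ adj z y)) /\
        exists u v, [/\ u \in W, v \in W, adj x u, adj u v & adj v y]]) ->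
  #|V| - #|W| <= mu adj.
Proof.
move=> H; rewrite -cardsT -cardsDS ?subsetT // setTD; apply: leq_mu => x y.
rewrite !inE => xW yW xy.
have long s : xy_walk adj x y s -> ~ adj x y -> 1 < size s.
  case: s => [[_ /= e]|z [|//]]; first by rewrite e eqxx in xy.
  by case=> [[a _] /= <-] /(_ a).
have [a|nadj] := pselect (adj x y).
  exists [:: y]; split; last by [].
  by split=> // -[[_ /= e]|//]; rewrite e eqxx in xy.
have [[w wW [xw wy]]|nlink] := pselect (exists2 w, w \in W & adj x w /\ adj w y).
  exists [:: w; y]; split; last by move=> v; rewrite !inE /= => /eqP->; rewrite negbK.
  by split=> // s /long/(_ nadj).
case: (H x y xW yW xy) => // -[nz [u [v [uW vW xu uv vy]]]].
exists [:: u; v; y]; split; last first.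
  by move=> w; rewrite !inE /= => /orP[]/eqP->; rewrite negbK.
split=> // s sxy; have := long s sxy nadj; rewrite /= leq_eqVlt => /orP[|//].
case: s sxy => [|z [|z' [|//]]] // [[xz [zy _]] /= e] _.
by case: (nz z); rewrite -e.
Qed.
End Graph.

(** * Disjoint and crossing segments in terms of orientations *)

Section Plane.
Local Open Scope ring_scope.
Variable R : realType.
Implicit Types a b c d u v z : point R.

(** Twice the signed area of the triangle, positive for a counterclockwise turn; [collinear] says
    that it vanishes. *)
Definition cross a b c : R :=
  (b.1 - a.1) * (c.2 - a.2) - (b.2 - a.2) * (c.1 - a.1).

Definition disjoint_segments a b c d : Prop :=
  ~ exists z, on_closed_segment a b z /\ on_closed_segment c d z.

Lemma disjoint_segmentsC a b c d :
  disjoint_segments a b c d -> disjoint_segments c d a b.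
Proof. by move=> H; case=> z [h1 h2]; apply: H; exists z. Qed.

(** [cross u v] is affine along a segment, so it is nonnegative on [ab] and negative on [cd]. The
    weak inequality on one side lets [a] or [b] lie on the separating line. *)
Lemma disjoint_of_sides u v a b c d :
  0 <= cross u v a -> 0 <= cross u v b -> cross u v c < 0 -> cross u v d < 0 ->
  disjoint_segments a b c d.
Proof.
move=> ha hb hc hd; case=> z [[t [t0 [t1 zt]]] [s [s0 [s1 zs]]]].
have z1 : cross u v z = (1 - t) * cross u v a + t * cross u v b.
  by rewrite zt /cross /=; ring.
have z2 : cross u v z = (1 - s) * cross u v c + s * cross u v d.
  by rewrite zs /cross /=; ring.
have : 0 <= cross u v z by rewrite z1; apply: addr_ge0; apply: mulr_ge0; lra.
rewrite z2; nra.
Qed.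

Lemma disjoint_same_side u v c d :
  cross u v c != 0 -> cross u v d != 0 ->
  (0 < cross u v c) = (0 < cross u v d) -> disjoint_segments u v c d.
Proof.
have E1 w w' : cross w w' w = 0 by rewrite /cross; ring.
have E2 w w' : cross w w' w' = 0 by rewrite /cross; ring.
have E3 w w' w'' : cross w w' w'' = - cross w' w w'' by rewrite /cross; ring.
move=> nc nd; case: (ltrgt0P (cross u v c)) nc => // hc _;
  case: (ltrgt0P (cross u v d)) nd => // hd _ // _.
  by apply: (@disjoint_of_sides v u); rewrite ?E1 ?E2 // E3 oppr_lt0.
by apply: (@disjoint_of_sides u v); rewrite ?E1 ?E2.
Qed.

(** Along each segment the affine function of the other line changes sign; its zero is the common
    point. *)
Lemma crossing_segments a b c d :
  cross a b c != 0 -> cross a b d != 0 -> cross c d a != 0 -> cross c d b != 0 ->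
  (0 < cross a b c) != (0 < cross a b d) ->
  (0 < cross c d a) != (0 < cross c d b) ->
  exists z, on_closed_segment a b z /\ on_closed_segment c d z.
Proof.
have frac (x y : R) : x != 0 -> y != 0 -> (0 < x) != (0 < y) ->
    [/\ x - y != 0, 0 <= x / (x - y) & x / (x - y) <= 1].
  move=> x0 y0; case: (ltrgt0P x) x0 => // hx _;
    case: (ltrgt0P y) y0 => // hy _ // _.
    have h : 0 < x - y by lra.
    by split; [rewrite gt_eqF | rewrite divr_ge0 ?ltW |
      rewrite ler_pdivrMr //; lra].
  have h : x - y < 0 by lra.
  split; first by rewrite lt_eqF.
    by rewrite -mulrNN -invrN divr_ge0 // oppr_ge0 ltW.
  by rewrite ler_ndivrMr //; lra.
move=> h1 h2 h3 h4 hc ha.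
have [n1 s0 s1] := frac _ _ h1 h2 hc; have [n2 t0 t1] := frac _ _ h3 h4 ha.
(* [t] is the parameter at which [cross c d] vanishes along [ab], and [s] the one at which
   [cross a b] vanishes along [cd]. *)
set t := cross c d a / _ in t0 t1; set s := cross a b c / _ in s0 s1.
exists (a.1 + t * (b.1 - a.1), a.2 + t * (b.2 - a.2)); split.
  by exists t.
exists s; split => //; split => //.
congr pair; rewrite /t /s; move: n1 n2; rewrite /cross => n1 n2; field; lra.
Qed.

(** The equation has the shape of a three-term Grassmann-Plücker relation. With positive
    coefficients, [x2] takes the common sign of [x1] and [x3] whenever these two agree. *)
Lemma plucker_no_spike (p1 p2 p3 x1 x2 x3 : R) :
  0 < p1 -> 0 < p2 -> 0 < p3 -> p2 * x2 = p1 * x3 + p3 * x1 ->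
  x1 != 0 -> x2 != 0 -> x3 != 0 ->
  ~~ (((0 < x1) == (0 < x3)) && ((0 < x1) != (0 < x2))).
Proof.
move=> h1 h2 h3 E n1 n2 n3.
case: (ltrgt0P x1) n1 => // q1 _; case: (ltrgt0P x2) n2 => // q2 _;
  case: (ltrgt0P x3) n3 => // q3 _ //; nra.
Qed.
End Plane.

(** * Clockwise order around an extreme point *)

Section RadialOrder.
Local Open Scope ring_scope.
Variables (R : realType) (n : nat) (p : 'I_n -> point R).
Hypothesis gp : general_position p.

Lemma cross_neq0 i j k : i != j -> j != k -> i != k -> cross (p i) (p j) (p k) != 0.
Proof. by move=> ij jk ik; apply/eqP; apply: (gp.2 i j k). Qed.

(** Seen from this point, all others lie in the right half-plane or straight above, a range of
    angles below a half-turn. This makes the clockwise comparison transitive. *)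
Lemma lexicographic_min (i0 : 'I_n) : exists a, forall i, i != a ->
  (p a).1 < (p i).1 \/ (p a).1 = (p i).1 /\ (p a).2 < (p i).2.
Proof.
case: (arg_minP (fun i => (p i).1) (isT : xpredT i0)) => b _ bmin.
case: (arg_minP (P := fun i => (p i).1 == (p b).1) (fun i => (p i).2) (eqxx (p b).1)).
move=> a /eqP ab amin; exists a => i ia.
have := bmin i isT; rewrite le_eqVlt => /orP[/eqP bi|bi]; last by left; rewrite ab.
have := amin i; rewrite bi eqxx => /(_ isT); rewrite le_eqVlt => /orP[/eqP ai|ai].
  case/eqP: ia; apply: gp.1.
  by rewrite [p i]surjective_pairing [p a]surjective_pairing ai ab bi.
by right; rewrite ab bi.
Qed.

Lemma radial_order (i0 : 'I_n) : exists s : seq 'I_n,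
  [/\ uniq s, size s = n &
    forall j k, (0 < j < k)%N -> (k < n)%N ->
      cross (p (nth i0 s 0)) (p (nth i0 s j)) (p (nth i0 s k)) < 0].
Proof.
have [a amin] := lexicographic_min i0.
pose le u v := (u == v) || (cross (p a) (p u) (p v) < 0).
pose P := [pred i | i != a].
have anti u v : cross (p a) (p v) (p u) = - cross (p a) (p u) (p v).
  by rewrite /cross; ring.
have tot : {in P &, total le}.
  move=> u v; rewrite !inE /le => ua va; case: eqVneq => //= uv.
  have := @cross_neq0 a u v; rewrite uv ![a == _]eq_sym ua va => /(_ isT isT isT).
  by rewrite (anti u v) oppr_lt0; case: ltrgt0P.
have tr : {in P & &, transitive le}.
  move=> v u w; rewrite !inE /le => va ua wa.
  case: (eqVneq u v) => [->//|uv] /=; case: (eqVneq v w) => [<- ->|vw /=]; first by rewrite orbT.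
  move=> cuv cvw; have cuw : cross (p a) (p u) (p w) <= 0.
    have := amin u ua; have := amin v va; have := amin w wa.
    move: cuv cvw; rewrite /cross.
    set x1 := (p u).1 - (p a).1; set y1 := (p u).2 - (p a).2.
    set x2 := (p v).1 - (p a).1; set y2 := (p v).2 - (p a).2.
    set x3 := (p w).1 - (p a).1; set y3 := (p w).2 - (p a).2.
    move=> c12 c23 w0 v0 u0.
    have h3 : 0 <= x3 by rewrite /x3; lra.
    have h1 : 0 <= x1 by rewrite /x1; lra.
    (* Straight up is the first direction in clockwise order, so [v], which has a predecessor [u],
       cannot lie there. *)
    have h2 : 0 < x2.
      rewrite /x2; case: v0 => [|[e f]]; first by lra.
      have x20 : x2 = 0 by rewrite /x2; lra.
      have y20 : 0 < y2 by rewrite /y2; lra.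
      by move: c12; rewrite x20; nra.
    (* A Plücker relation: the right-hand side is nonpositive and [x2] is positive. General position
       then makes the inequality strict. *)
    have E : x2 * (x1 * y3 - y1 * x3) = x3 * (x1 * y2 - y1 * x2) + x1 * (x2 * y3 - y2 * x3).
      by ring.
    by nra.
  case: (eqVneq u w) => //= uw.
  have := @cross_neq0 a u w; rewrite uw ![a == _]eq_sym ua wa => /(_ isT isT isT).
  by move: cuw; rewrite le_eqVlt => /orP[->|].
pose t := sort le (rem a (enum 'I_n)).
have tu : uniq t by rewrite sort_uniq rem_uniq ?enum_uniq.
have memt : forall i, (i \in t) = (i != a).
  by move=> i; rewrite mem_sort mem_rem_uniq ?enum_uniq // !inE mem_enum andbT.
have ts : sorted le t.
  apply: (sort_sorted_in tot); apply/allP => i; rewrite mem_rem_uniq ?enum_uniq //.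
  by rewrite !inE => /andP[].
have st : size t = n.-1 by rewrite size_sort size_rem ?mem_enum // size_enum_ord.
have n0 : (0 < n)%N by case: (n) i0 => // -[].
exists (a :: t); split=> /=; [by rewrite tu memt eqxx|by rewrite st prednK|].
move=> [|j] [|k] //= jk kn.
have tP : all P t by apply/allP => i; rewrite memt.
have jn : (j < size t)%N by rewrite st; lia.
have kn' : (k < size t)%N by rewrite st; lia.
have := sorted_ltn_nth_in tr i0 tP ts j k jn kn' jk; rewrite /le nth_uniq //.
by rewrite ltn_eqF.
Qed.
End RadialOrder.

(** * Orientation tables and the finite check *)

Definition edge := (nat * nat)%type.
(** Points are named by natural numbers, clockwise around point 0;
    [Some true] means that [i], [j], [k] (i < j < k) turn counterclockwise, [None]
    that the orientation is unknown. *)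
Definition signs := nat -> nat -> nat -> option bool.

(** An unknown orientation makes both [agree] and [differ] fail, so neither is the negation of the
    other and every test built on them errs on the safe side. *)
Definition agree (x y : option bool) : bool :=
  match x, y with Some b, Some c => b == c | _, _ => false end.
Definition differ (x y : option bool) : bool :=
  match x, y with Some b, Some c => b != c | _, _ => false end.

(** A sufficient test for [ab] and [cd] to be disjoint, when a < b, c < d, a < c.
    Among the orientations of the four triples of [a], [b], [c], [d], taken in
    lexicographic order, at most one change of sign occurs; this is why two
    orientations suffice in the last two cases. *)
Definition apart_lt (s : signs) (a b c d : nat) : bool :=
  if b < c then true
  else if b == c then false
  else if a == 0 then
    if d < b then true else if d == b then false else agree (s c b d) (Some true)
  else if b == d then false
  else if b < d then
    let x1 := s a c b in let x2 := s a c d in let x3 := s a b d in let x4 := s c b d in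
    [|| differ x1 x2, differ x1 x3, differ x1 x4, differ x2 x3, differ x2 x4
      | differ x3 x4]
  else
    let x1 := s a c d in let x2 := s a c b in let x3 := s a d b in let x4 := s c d b in
    [|| agree x1 x4, agree x2 x3, agree x2 x4 | agree x1 x3].

Definition apart (s : signs) (e f : edge) : bool :=
  let (a, b) := e in let (c, d) := f in
  if a < c then apart_lt s a b c d
  else if c < a then apart_lt s c d a b else false.

(** A sufficient test only: crossings of nested pairs [a < c < d < b] are not reported. *)
Definition meet_lt (s : signs) (a b c d : nat) : bool :=
  [|| b == c, b == d | [&& c < b, b < d &
    if a == 0 then agree (s c b d) (Some false)
    else agree (s a c b) (s a b d) && agree (s a c d) (s c b d)]].

Definition meet (s : signs) (e f : edge) : bool :=
  let (a, b) := e in let (c, d) := f in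
  if a < c then meet_lt s a b c d
  else if c < a then meet_lt s c d a b else true.

Definition table := seq (seq (seq (option bool))).
Definition get (tb : table) a b c : option bool :=
  nth None (nth [::] (nth [::] tb a) b) c.
Definition put (tb : table) a b c (v : bool) : table :=
  let ta := nth [::] tb a in
  set_nth [::] tb a (set_nth [::] ta b (set_nth None (nth [::] ta b) c (Some v))).

Definition triple := (nat * nat * nat)%type.
Definition get3 tb (t : triple) := let: (a, b, c) := t in get tb a b c.
Definition put3 tb (t : triple) v := let: (a, b, c) := t in put tb a b c v.

(** For triples [x], [y], [z] whose orientations change at most once. *)
Definition infer (tb : table) (xyz : triple * triple * triple) : table :=
  let: (x, y, z) := xyz in
  match get3 tb x, get3 tb y, get3 tb z with
  | Some u, None, Some w => if u == w then put3 tb y u else tb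
  | Some u, Some v, None => if u == v then tb else put3 tb z v
  | None, Some v, Some w => if v == w then tb else put3 tb x v
  | _, _, _ => tb
  end.

(** Label 0 is the centre, 1 to 4 are the first four points in angular order, 6 to
    [T] the last [T - 5]; label 5 stands for any point in the gap. *)
Definition labels T := iota 0 5 ++ iota 6 (T - 5).
Definition points T := iota 1 4 ++ iota 6 (T - 5).
Definition edges T : seq edge :=
  [seq e <- [seq (a, b) | a <- labels T, b <- labels T] | e.1 < e.2].

(** Four signs change at most once exactly when no three of them, in order, change twice; hence the
    four subsequences for each quadruple. Triples with point 0 have a fixed orientation and do not
    occur. *)
Definition inferences T : seq (triple * triple * triple) :=
  let up a := [seq b <- points T | a < b] in
  flatten [seq flatten [seq flatten [seq flatten [seq
    (let x := (a, b, c) in let y := (a, b, d) in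
     let z := (a, c, d) in let t := (b, c, d) in
     [:: (x, y, z); (x, y, t); (x, z, t); (y, z, t)])
    | d <- up c] | c <- up b] | b <- up a] | a <- points T].

(** Three rounds of inference are enough for the trees below. *)
Definition close (ts : seq (triple * triple * triple)) (tb : table) : table :=
  iter 3 (fun tb => foldl infer tb ts) tb.

Fixpoint lookup (j : nat) (acc : seq (nat * bool)) : option bool :=
  if acc is (k, b) :: acc' then if k == j then Some b else lookup j acc' else None.

(** [acc] lists, for kept points [j], the orientation of [i], [j], 5 sorted. *)
Definition extend tb i acc : signs := fun a b c =>
  let look u v := if u == i then lookup v acc
                  else if v == i then lookup u acc else None in
  if a == 5 then look b c else if b == 5 then look a c
  else if c == 5 then look a b else get tb a b c.

Definition arm_edge i : edge := if i < 5 then (i, 5) else (5, i).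

(** Two sign changes in a row, the pattern excluded by [plucker_no_spike]. *)
Definition spike (x y z : bool) := (x == z) && (x != y).

(** For [j < k], the gap label 5 comes first, in the middle or last among 5, [j], [k]. This decides
    where the known orientation [x] of [i], [j], [k] stands in the sequence that must not spike. *)
Definition compatible tb i j k (tj tk : bool) : bool :=
  let x := if i < j then get tb i j k else if i < k then get tb j i k
           else get tb j k i in
  if x is Some x then
    ~~ (if 5 < j then spike tj tk x else if 5 < k then spike tj x tk
        else spike x tj tk)
  else true.

(** All positions of a gap point relative to the lines through [i] that do not
    contradict the known orientations. *)
Fixpoint arms tb i (js : seq nat) (acc : seq (nat * bool)) : seq (seq (nat * bool)) :=
  if js is k :: js' then
    (if all (fun jb => compatible tb i jb.1 k jb.2 false) acc
     then arms tb i js' ((k, false) :: acc) else [::]) ++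
    (if all (fun jb => compatible tb i jb.1 k jb.2 true) acc
     then arms tb i js' ((k, true) :: acc) else [::])
  else [:: acc].

(** [Arm i acc] stands for the segments from [i] to a gap point seen as in [acc],
    and [Far] for the segments between two gap points. *)
Inductive pattern := Seg of edge | Arm of nat & seq (nat * bool) | Far.

Definition pattern_code (q : pattern) : edge + option (nat * seq (nat * bool)) :=
  match q with Seg e => inl e | Arm i acc => inr (Some (i, acc)) | Far => inr None end.
Definition pattern_decode (c : edge + option (nat * seq (nat * bool))) : pattern :=
  match c with inl e => Seg e | inr (Some (i, acc)) => Arm i acc | inr None => Far end.
Lemma pattern_codeK : cancel pattern_code pattern_decode.
Proof. by case. Qed.
HB.instance Definition _ := Equality.copy pattern (can_type pattern_codeK).

(** For [Far], the accepted edges are separated by angle from the gap: they start at the centre or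
    stay on one side of the gap. *)
Definition avoids tb (p : pattern) (e : edge) : bool :=
  match p with
  | Seg f => apart (get tb) f e
  | Arm i acc => apart (extend tb i acc) (arm_edge i) e
  | Far => [|| e.1 == 0, e.2 < 5 | 5 < e.1]
  end.

Definition segs T (W : seq edge) : seq edge := [seq e <- edges T | e \notin W].

(** Points are left out only for [T = 8]. From the centre only separation by angle is used, hence
    the empty sign list of [Arm 0]. *)
Definition rays T tb : seq pattern :=
  if T == 8 then
    Far :: Arm 0 [::] ::
    flatten [seq [seq Arm i acc | acc <- arms tb i [seq j <- points T | j != i] [::]]
            | i <- points T]
  else [::].

(** To exclude every common neighbour, all segments must be among [edges T]; for [T = 8] segments
    ending in the gap could be further common neighbours. *)
Definition three_path T tb (W : seq edge) (e f : edge) : bool :=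
  [&& T != 8,
   all (fun g => meet (get tb) e g || meet (get tb) f g) (edges T) &
   has (fun u => apart (get tb) e u &&
     has (fun v => apart (get tb) u v && apart (get tb) v f) W) W].

Definition hits tb (W : seq edge) p : bitseq := [seq avoids tb p e | e <- W].

Fixpoint overlap (r s : bitseq) : bool :=
  match r, s with
  | b :: r', c :: s' => if b && c then true else overlap r' s'
  | _, _ => false
  end.

(** Boolean [if]s instead of [||] keep call-by-value evaluation lazy. *)
Definition check T tb (W : seq edge) : bool :=
  let S := [seq (e, hits tb W (Seg e)) | e <- segs T W] in
  let R := [seq (p, hits tb W p) | p <- rays T tb] in
  let B := undup (unzip2 R) in
  [&& allrel (fun x y => if overlap x.2 y.2 then true else if x.1 == y.1 then true
                        else if apart (get tb) x.1 y.1 then true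
                        else three_path T tb W x.1 y.1) S S,
      allrel (fun x y => if overlap x.2 y.2 then true else avoids tb y.1 x.1) S R &
      allrel overlap B B].

Inductive dtree := Leaf of nat | Node of nat & nat & nat & dtree & dtree.

Fixpoint verify_from T ts pool tb (t : dtree) : bool :=
  match t with
  | Leaf w => check T tb (nth [::] pool w)
  | Node a b c l r => verify_from T ts pool (close ts (put tb a b c false)) l &&
                   verify_from T ts pool (close ts (put tb a b c true)) r
  end.

Definition verify T pool t := verify_from T (inferences T) pool [::] t.

(** * Soundness of the check *)

Section Configuration.
Local Open Scope ring_scope.
Variables (R : realType) (f : nat -> point R) (valid : pred nat).

Definition sign i j k : bool := 0 < cross (f i) (f j) (f k).

(** All that the combinatorial part retains of the geometry. The first clause fixes the orientations
    of triples with point 0, so tables concern positive labels only; [valid] allows the gap label 5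
    to be included or not. *)
Definition radial : Prop :=
  (forall i j, (0 < i < j)%N -> valid i -> valid j -> cross (f 0) (f i) (f j) < 0) /\
  (forall i j k, (0 < i < j)%N -> (j < k)%N -> valid i -> valid j -> valid k ->
    cross (f i) (f j) (f k) != 0).

Hypothesis fP : radial.

Definition sorted_sign i j k : bool :=
  if (i < j)%N then sign i j k else if (i < k)%N then sign j i k else sign j k i.

(** The Plücker relation of the centre, [i], [a], [b], [c]. Moving [i] past another label flips an
    orientation and an area at the centre together, so after sorting the coefficients are positive
    for all four positions of [i]. *)
Lemma sorted_sign_no_spike i a b c :
  valid i -> valid a -> valid b -> valid c -> (0 < i)%N -> (0 < a)%N ->
  (a < b < c)%N -> i != a -> i != b -> i != c ->
  ~~ spike (sorted_sign i a b) (sorted_sign i a c) (sorted_sign i b c).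
Proof.
case: fP => neg nz vi va vb vc i0 a0 /andP[ab bc] ia ib ic.
pose q j k := - cross (f 0) (f j) (f k).
have qP j k : (0 < j < k)%N -> valid j -> valid k -> 0 < q j k.
  by move=> jk vj vk; rewrite oppr_gt0; apply: neg.
rewrite /sorted_sign /spike /sign.
case: (ltngtP i a) ia => // ia _.
  rewrite (ltn_trans ia ab).
  apply: (@plucker_no_spike _ (q i a) (q i b) (q i c));
    rewrite ?qP ?nz //; try lia.
  by rewrite /q /cross; ring.
case: (ltngtP i b) ib => // ib _.
  rewrite (ltn_trans ib bc).
  apply: (@plucker_no_spike _ (q a i) (q i b) (q i c));
    rewrite ?qP ?nz //; try lia.
  by rewrite /q /cross; ring.
case: (ltngtP i c) ic => // ic _.
  apply: (@plucker_no_spike _ (q a i) (q b i) (q i c));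
    rewrite ?qP ?nz //; try lia.
  by rewrite /q /cross; ring.
apply: (@plucker_no_spike _ (q a i) (q b i) (q c i));
  rewrite ?qP ?nz //; try lia.
by rewrite /q /cross; ring.
Qed.

Definition sound (s : signs) : Prop :=
  forall i j k v, (0 < i < j)%N -> (j < k)%N -> valid i -> valid j -> valid k ->
    s i j k = Some v -> sign i j k = v.

Variable s : signs.
Hypothesis sP : sound s.

Lemma agree_sound i j k i' j' k' : agree (s i j k) (s i' j' k') ->
  (0 < i < j)%N -> (j < k)%N -> (0 < i' < j')%N -> (j' < k')%N ->
  valid i -> valid j -> valid k -> valid i' -> valid j' -> valid k' ->
  sign i j k = sign i' j' k'.
Proof.
case E: (s i j k) => [u|//]; case E': (s i' j' k') => [u'|//] /eqP h *.
by rewrite (sP _ _ _ _ _ E) // (sP _ _ _ _ _ E').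
Qed.

Lemma differ_sound i j k i' j' k' : differ (s i j k) (s i' j' k') ->
  (0 < i < j)%N -> (j < k)%N -> (0 < i' < j')%N -> (j' < k')%N ->
  valid i -> valid j -> valid k -> valid i' -> valid j' -> valid k' ->
  sign i j k != sign i' j' k'.
Proof.
case E: (s i j k) => [u|//]; case E': (s i' j' k') => [u'|//] h *.
by rewrite (sP _ _ _ _ _ E) // (sP _ _ _ _ _ E').
Qed.

(** Each of [a], [b], [c], [d] taken as the pivot [i] of [sorted_sign_no_spike] gives one of the
    four clauses. *)
Lemma signs_of_quad a b c d : (0 < a < b)%N -> (b < c < d)%N ->
  valid a -> valid b -> valid c -> valid d ->
  [/\ ~~ spike (sign a b c) (sign a b d) (sign a c d),
      ~~ spike (sign a b c) (sign a b d) (sign b c d),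
      ~~ spike (sign a b c) (sign a c d) (sign b c d) &
      ~~ spike (sign a b d) (sign a c d) (sign b c d)].
Proof.
move=> /andP[a0 ab] /andP[bc cd] va vb vc vd.
have [ac bd] := (ltn_trans ab bc, ltn_trans bc cd).
have ad := ltn_trans ac cd; have b0 := ltn_trans a0 ab.
have F x y : (x < y)%N -> (y < x)%N = false by move=> xy; lia.
have N := fun i x y z vi vx vy vz => @sorted_sign_no_spike i x y z vi vx vy vz.
have := N a b c d va vb vc vd a0 b0; have := N b a c d vb va vc vd b0 a0.
have := N c a b d vc va vb vd; have := N d a b c vd va vb vc.
rewrite /sorted_sign ?ab ?ac ?ad ?bc ?bd ?cd.
rewrite !(F _ _ ab, F _ _ ac, F _ _ ad, F _ _ bc, F _ _ bd, F _ _ cd).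
move=> H1 H2 H3 H4; split; [apply: H4|apply: H3|apply: H2|apply: H1]; clear -a0 ab bc cd; lia.
Qed.

Lemma apart_lt_sound a b c d : (a < b)%N -> (c < d)%N -> (a < c)%N ->
  valid a -> valid b -> valid c -> valid d -> apart_lt s a b c d ->
  disjoint_segments (f a) (f b) (f c) (f d).
Proof.
case: fP => neg nz ab cd ac va vb vc vd; rewrite /apart_lt.
have cx x y z : cross x y z = cross y z x by rewrite /cross; ring.
have cL x y z : cross x y z = - cross x z y by rewrite /cross; ring.
have c1 x y : cross x y x = 0 by rewrite /cross; ring.
have c2 x y : cross x y y = 0 by rewrite /cross; ring.
have flip x y z : cross x y z != 0 -> (0 < cross x z y) = ~~ (0 < cross x y z).
  by rewrite [cross x z y]cL oppr_gt0; case: ltrgt0P.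
case: ltnP => [bc _|cb].
  (* The line through the centre and [b] separates: [c] and [d] come strictly later in the clockwise
     order. *)
  apply: (@disjoint_of_sides _ (f 0) (f b)); rewrite ?c2 ?neg //; try lia.
  have [->|a0] := posnP a; first by rewrite c1.
  by rewrite cL oppr_ge0 ltW // neg //; lia.
case: eqP => // /eqP nbc; have {nbc}cb : (c < b)%N by lia.
have [a0|a0] := posnP a.
  rewrite a0; case: ltnP => [db _|bd].
    by apply: (@disjoint_of_sides _ (f b) (f 0)); rewrite ?c1 ?c2 // cx neg //; lia.
  case: eqP => // /eqP ndb; have {ndb}bd : (b < d)%N by lia.
  case E: (s c b d) => [v|//] /eqP ev; move: E; rewrite ev.
  move=> /sP; rewrite /sign => /(_ _ _ vc vb vd) h.
  (* The centre and [b] lie strictly on the same side of the line [cd]. *)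
  apply: disjoint_segmentsC; apply: (@disjoint_of_sides _ (f c) (f d)); rewrite ?c1 ?c2 //.
    by rewrite -cx neg //; lia.
  by rewrite cL oppr_lt0 h //; lia.
case: eqP => // /eqP nbd.
case: ltnP => [bd|db].
  have [] := @signs_of_quad a c b d; rewrite ?a0 ?ac ?cb ?bd //.
  move=> S1 S2 S3 S4 H.
  (* Interleaved segments cross only if all four signs agree. A single change before the last sign
     puts [c] and [d] on one side of [ab]; a change at the last sign puts [a] and [b] on one side of
     [cd]. *)
  have {H S1 S2 S3 S4} : (sign a c b != sign a b d) || (sign a c d != sign c b d).
    have [oac ocb oab] : [/\ 0 < a < c, 0 < c < b & 0 < a < b]%N.
      by rewrite a0 ac cb ab (ltn_trans a0 ac).
    case/orP: H => [H|/orP[H|/orP[H|/orP[H|/orP[H|H]]]]];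
      have {}H := differ_sound H; do 10 specialize (H ltac:(assumption));
      move: H S1 S2 S3 S4; rewrite /spike;
      by case: (sign a c b) (sign a c d) (sign a b d) (sign c b d) => [] [] [] [].
  have nz' i j k : (0 < i < j)%N -> (j < k)%N -> valid i -> valid j -> valid k ->
      cross (f i) (f k) (f j) != 0.
    by move=> *; rewrite cL oppr_eq0 nz.
  have nz'' i j k : (0 < i < j)%N -> (j < k)%N -> valid i -> valid j -> valid k ->
      cross (f j) (f k) (f i) != 0.
    by move=> *; rewrite -cx nz.
  rewrite /sign => /orP[H|H].
    apply: disjoint_same_side; [by apply: nz' => //; lia|by apply: nz => //; lia|].
    rewrite flip; last by apply: nz => //; lia.
    by move: H; case: (0 < _) (0 < _) => [] [].
  apply: disjoint_segmentsC; apply: disjoint_same_side;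
    [by apply: nz'' => //; lia|by apply: nz' => //; lia|].
  rewrite -cx [RHS]flip; last by apply: nz => //; lia.
  by move: H; case: (0 < _) (0 < _) => [] [].
have {nbd}db : (d < b)%N by lia.
have [] := @signs_of_quad a c d b; rewrite ?a0 ?ac ?cd ?db //.
move=> S1 S2 S3 S4 H.
(* Nested segments cross only if the single change falls between the second and third sign. Each
   accepted agreement excludes that. *)
have {H S1 S2 S3 S4} : (sign a c d == sign c d b) || (sign a c b == sign a d b).
  have [oac ocd oad] : [/\ 0 < a < c, 0 < c < d & 0 < a < d]%N.
    by rewrite a0 ac cd (ltn_trans a0 ac) (ltn_trans ac cd).
  case/orP: H => [H|/orP[H|/orP[H|H]]];
    have {}H := agree_sound H; do 10 specialize (H ltac:(assumption));
    move: H S1 S2 S3 S4; rewrite /spike;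
    by case: (sign a c b) (sign a c d) (sign a d b) (sign c d b) => [] [] [] [].
rewrite /sign => /orP[/eqP H|/eqP H].
  apply: disjoint_segmentsC; apply: disjoint_same_side; last by rewrite -cx.
    by rewrite -cx; apply: nz => //; lia.
  by apply: nz => //; lia.
have h x y z : cross x y z != 0 -> cross x z y != 0 by rewrite cL oppr_eq0.
apply: disjoint_same_side; [by apply/h/nz => //; lia|by apply/h/nz => //; lia|].
rewrite [LHS]flip; last by apply: nz => //; clear -a0 ac cd; lia.
by rewrite [RHS]flip ?H //; apply: nz => //; clear -a0 ac cd db; lia.
Qed.

Lemma apart_sound e f' : (e.1 < e.2)%N -> (f'.1 < f'.2)%N ->
  valid e.1 -> valid e.2 -> valid f'.1 -> valid f'.2 -> apart s e f' ->
  disjoint_segments (f e.1) (f e.2) (f f'.1) (f f'.2).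
Proof.
case: e f' => [a b] [c d] /= ab cd va vb vc vd; rewrite /apart.
case: ltnP => [ac|_]; first exact: apart_lt_sound.
by case: ltnP => // ca /apart_lt_sound h; apply: disjoint_segmentsC; apply: h.
Qed.

(** For interleaved labels away from the centre, the two equalities say that each segment has its
    ends on opposite sides of the line of the other. *)
Lemma meet_sound e f' : (e.1 < e.2)%N -> (f'.1 < f'.2)%N ->
  valid e.1 -> valid e.2 -> valid f'.1 -> valid f'.2 -> meet s e f' ->
  exists z, on_closed_segment (f e.1) (f e.2) z /\ on_closed_segment (f f'.1) (f f'.2) z.
Proof.
have onl x y : on_closed_segment x y x.
  by exists 0; rewrite lexx ler01 !mul0r !addr0 -surjective_pairing.
have onr x y : on_closed_segment x y y.
  exists 1; rewrite lexx ler01 !mul1r; split=> //; split=> //.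
  by rewrite [y]surjective_pairing /=; congr pair; ring.
have lt a b c d : (a < b)%N -> (c < d)%N -> (a < c)%N ->
    valid a -> valid b -> valid c -> valid d -> meet_lt s a b c d ->
    exists z, on_closed_segment (f a) (f b) z /\ on_closed_segment (f c) (f d) z.
  move=> ab cd ac va vb vc vd; rewrite /meet_lt.
  case/or3P=> [/eqP<-|/eqP<-|/and3P[cb bd]]; [by exists (f b)|by exists (f b)|].
  case: fP => neg nz.
  have cx x y z : cross x y z = cross y z x by rewrite /cross; ring.
  have cL x y z : cross x y z = - cross x z y by rewrite /cross; ring.
  have flip x y z : cross x y z != 0 -> (0 < cross x z y) = ~~ (0 < cross x y z).
    by rewrite [cross x z y]cL oppr_gt0; case: ltrgt0P.
  have h x y z : cross x y z != 0 -> cross x z y != 0 by rewrite cL oppr_eq0.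
  have nn i j : (0 < i < j)%N -> valid i -> valid j -> cross (f 0) (f i) (f j) != 0.
    by move=> *; rewrite lt_eqF // neg.
  have [a0|a0] := posnP a.
    rewrite a0; case E: (s c b d) => [v|//] /eqP ev; move: E; rewrite ev.
    move=> /sP; rewrite /sign => /(_ _ _ vc vb vd) hs.
    have c0 : (0 < c)%N by rewrite -a0.
    have b0 := ltn_trans c0 cb.
    have [ncb nbd ncd] : [/\ cross (f 0) (f c) (f b) < 0, cross (f 0) (f b) (f d) < 0
        & cross (f 0) (f c) (f d) < 0].
      by split; apply: neg => //; rewrite ?c0 ?b0.
    have F (x : R) : x < 0 -> (0 < x) = false by move=> x0; rewrite ltNge ltW.
    have p : 0 < cross (f c) (f b) (f d) = false by apply: hs => //; rewrite c0.
    have q : cross (f c) (f b) (f d) != 0 by apply: nz => //; rewrite c0.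
    apply: crossing_segments.
    - by apply/h; rewrite lt_eqF.
    - by rewrite lt_eqF.
    - by rewrite -cx lt_eqF.
    - exact: h.
    - rewrite [in X in X != _]flip; last by rewrite lt_eqF.
      by rewrite (F _ ncb) (F _ nbd).
    - by rewrite -cx [in X in _ != X]flip // p (F _ ncd).
  have [oac ocb oab] : [/\ 0 < a < c, 0 < c < b & 0 < a < b]%N.
    by rewrite a0 ac cb ab (ltn_trans a0 ac).
  case/andP => H1 H2.
  have {}H1 := agree_sound H1; do 10 specialize (H1 ltac:(assumption)).
  have {}H2 := agree_sound H2; do 10 specialize (H2 ltac:(assumption)).
  move: H1 H2; rewrite /sign => H1 H2.
  apply: crossing_segments.
  - by apply/h/nz => //; lia.
  - by apply: nz => //; lia.
  - by rewrite -cx; apply: nz => //; lia.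
  - by apply/h/nz => //; lia.
  - rewrite [in X in X != _]flip; last by apply: nz.
    by rewrite H1; case: (0 < _).
  - rewrite -cx H2 [in X in _ != X]flip; last by apply: nz.
    by case: (0 < _).
case: e f' => [a b] [c d] /= ab cd va vb vc vd; rewrite /meet.
case: ltnP => [ac|ca]; first exact: lt.
case: ltnP => [ca'|ac].
  by move=> /lt [] // z [h1 h2]; exists z.
have -> : c = a by lia.
by exists (f a).
Qed.
End Configuration.

Lemma get_put tb a b c v i j k :
  get (put tb a b c v) i j k =
  if [&& i == a, j == b & k == c] then Some v else get tb i j k.
Proof.
rewrite /get /put nth_set_nth /=; case: eqP => [->|//] /=.
rewrite nth_set_nth /=; case: eqP => [->|//] /=.
by rewrite nth_set_nth /=; case: eqP.
Qed.

Lemma overlapP (T : Type) (f g : T -> bool) (s : seq T) :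
  overlap [seq f x | x <- s] [seq g x | x <- s] = has (fun x => f x && g x) s.
Proof. by elim: s => //= x s ->; case: ifP. Qed.

Lemma mem_labels T l : (l \in labels T) = (l < 5) || (5 < l <= T).
Proof. by rewrite /labels mem_cat !mem_iota; lia. Qed.

Lemma mem_edges T e : (e \in edges T) = [&& e.1 \in labels T, e.2 \in labels T & e.1 < e.2].
Proof.
rewrite mem_filter andbC andbA; congr andb.
apply/allpairsP/andP => /= [[[a b] /= [ha hb ->]] //|[ha hb]].
by exists e; split=> //; case: (e).
Qed.

Lemma labels_neq5 T a : a \in labels T -> a != 5.
Proof. by rewrite mem_labels; lia. Qed.

(** * Soundness of inference and of the decision tree *)

Section Tables.
Variables (R : realType) (f : nat -> point R) (T : nat).

Lemma mem_points a : (a \in points T) = (a \in labels T) && (0 < a).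
Proof. by rewrite /points /labels !mem_cat !mem_iota; lia. Qed.

Let valid a := a \in labels T.
Hypothesis fP : radial f valid.

Lemma sound_put tb a b c : sound f valid (get tb) ->
  sound f valid (get (put tb a b c (sign f a b c))).
Proof.
move=> h i j k v i0 jk vi vj vk; rewrite get_put.
by case: ifP => [/and3P[/eqP-> /eqP-> /eqP->] [->]|_]; last exact: h.
Qed.

(** [X] stands for the true orientations; keeping it abstract reduces [infer_sound] to a case
    analysis on booleans. *)
Definition inference_sound (xyz : triple * triple * triple) : Prop :=
  let: (x, y, z) := xyz in
  exists X : triple -> bool,
  [/\ forall tb, sound f valid (get tb) -> forall t v, t \in [:: x; y; z] ->
        get3 tb t = Some v -> X t = v,
      forall tb t, sound f valid (get tb) -> sound f valid (get (put3 tb t (X t))) &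
      ~~ spike (X x) (X y) (X z)].

Lemma infer_sound tb xyz : inference_sound xyz ->
  sound f valid (get tb) -> sound f valid (get (infer tb xyz)).
Proof.
case: xyz => [[x y] z] [X [known put spk]] tbP; rewrite /infer.
have kx := known _ tbP x; have ky := known _ tbP y; have kz := known _ tbP z.
move: spk; rewrite /spike.
case: (get3 tb x) kx => [u|] kx; case: (get3 tb y) ky => [v|] ky;
  case: (get3 tb z) kz => [w|] kz //=.
- rewrite (kx u) ?inE ?eqxx // (ky v) ?inE ?eqxx ?orbT // => S.
  case: eqP => // nuv; have <- : X z = v by case: (X z) u v nuv S {kx ky} => [] [] [].
  exact: put.
- rewrite (kx u) ?inE ?eqxx // (kz w) ?inE ?eqxx ?orbT // => S.
  case: eqP => // nuv; have <- : X y = u by case: (X y) u w nuv S {kx kz} => [] [] [].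
  exact: put.
- rewrite (ky v) ?inE ?eqxx ?orbT // (kz w) ?inE ?eqxx ?orbT // => S.
  case: eqP => // nuv; have <- : X x = v by case: (X x) v w nuv S {ky kz} => [] [] [].
  exact: put.
Qed.

Lemma inferences_sound xyz : xyz \in inferences T -> inference_sound xyz.
Proof.
pose X (t : triple) := let: (a, b, c) := t in sign f a b c.
case/flatten_mapP => a va /flatten_mapP[b]; rewrite mem_filter => /andP[ab vb].
case/flatten_mapP => c; rewrite mem_filter => /andP[bc vc].
case/flatten_mapP => d; rewrite mem_filter => /andP[cd vd].
move: va vb vc vd; rewrite !mem_points => /andP[va a0] /andP[vb b0] /andP[vc c0] /andP[vd d0].
have [S1 S2 S3 S4] : [/\ ~~ spike (X (a, b, c)) (X (a, b, d)) (X (a, c, d)),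
      ~~ spike (X (a, b, c)) (X (a, b, d)) (X (b, c, d)),
      ~~ spike (X (a, b, c)) (X (a, c, d)) (X (b, c, d)) &
      ~~ spike (X (a, b, d)) (X (a, c, d)) (X (b, c, d))].
  by apply: (signs_of_quad fP); rewrite ?a0 ?bc.
have put tb t : sound f valid (get tb) -> sound f valid (get (put3 tb t (X t))).
  by case: t => [[i j] k]; apply: sound_put.
have known tb : sound f valid (get tb) -> forall t v,
    t \in [:: (a, b, c); (a, b, d); (a, c, d); (b, c, d)] ->
    get3 tb t = Some v -> X t = v.
  have [ac bd] := (ltn_trans ab bc, ltn_trans bc cd).
  by move=> h t v; rewrite !inE => /or4P[] /eqP-> /h; apply=> //; rewrite ?a0 ?b0.
rewrite !inE => /or4P[] /eqP->; exists X; split=> // tb /known h t v.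
all: by rewrite !inE => /or3P[] /eqP-> E; apply: h; rewrite ?E // !inE eqxx ?orbT.
Qed.

Lemma close_sound tb : sound f valid (get tb) ->
  sound f valid (get (close (inferences T) tb)).
Proof.
have foldlP l tb' : {subset l <= inferences T} -> sound f valid (get tb') ->
    sound f valid (get (foldl infer tb' l)).
  elim: l tb' => [|x l IH] tb' sub tbP'; first exact: tbP'.
  rewrite [foldl _ _ _]/=.
  apply: IH => [y ys|]; first by apply: sub; rewrite inE ys orbT.
  by apply: infer_sound => //; apply/inferences_sound/sub; rewrite inE eqxx.
move=> tbP; have sub : {subset inferences T <= inferences T} by move=> x.
exact: foldlP sub (foldlP _ _ sub (foldlP _ _ sub tbP)).
Qed.

(** Descending along the true orientations keeps the table sound, starting from the empty table,
    which claims nothing. *)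
Lemma verify_sound pool t : verify T pool t ->
  exists tb w, sound f valid (get tb) /\ check T tb (nth [::] pool w).
Proof.
have : sound f valid (get [::]) by move=> i j k v; rewrite /get !nth_nil.
rewrite /verify; elim: t [::] => [w|a b c l IHl r IHr] tb tbP /=.
  by exists tb, w.
case/andP => hl hr.
have := close_sound (sound_put (a := a) (b := b) (c := c) tbP).
by case: (sign f a b c) => h; [exact: IHr hr|exact: IHl hl].
Qed.
End Tables.

(** * Segments from a kept point to a gap point *)

Section Arms.
Variables (R : realType) (f : nat -> point R) (T : nat) (tb : table).
Let valid a := (a == 5) || (a \in labels T).
Hypothesis fP : radial f valid.
Hypothesis tbP : sound f (fun a => a \in labels T) (get tb).
Variable i : nat.
Hypothesis iT : i \in labels T.

Definition arm_sign j : bool :=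
  if j < 5 then sorted_sign f i j 5 else sorted_sign f i 5 j.

Lemma compatible_sound j k : 0 < i -> j \in points T -> k \in points T -> j != i -> k != i ->
  j < k -> compatible tb i j k (arm_sign j) (arm_sign k).
Proof.
rewrite !mem_points => i0 /andP[vj j0] /andP[vk k0] ji ki jk.
have [i5 j5 k5] := And3 (labels_neq5 iT) (labels_neq5 vj) (labels_neq5 vk).
rewrite /compatible.
case E : (if _ then _ else _) => [x|//].
have -> : x = sorted_sign f i j k.
  rewrite /sorted_sign; move: E.
  case: (ltngtP i j) ji => // ij _; first by move/tbP => -> //; lia.
  by case: (ltngtP i k) ki => // ik _ /tbP -> //; lia.
rewrite /arm_sign.
have S a b c : valid a -> valid b -> valid c -> 0 < a -> a < b < c -> i != a -> i != b ->
    i != c -> ~~ spike (sorted_sign f i a b) (sorted_sign f i a c) (sorted_sign f i b c).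
  by move=> *; apply: (sorted_sign_no_spike fP) => //; rewrite /valid iT orbT.
have [vj' vk' v5] : [/\ valid j, valid k & valid 5] by rewrite /valid vj vk !orbT.
case: (ltngtP j 5) j5 => // j5 _; case: (ltngtP k 5) k5 => // k5 _; try lia.
all: by apply: S => //; lia.
Qed.

(** The list of true signs survives the pruning, since true signs are always compatible. *)
Lemma arms_sound js : 0 < i -> sorted ltn js ->
  (forall j, j \in js -> (j \in points T) && (j != i)) ->
  exists2 acc, acc \in arms tb i js [::] & forall j b, lookup j acc = Some b -> b = arm_sign j.
Proof.
move=> i0.
pose P acc := all (fun jb => [&& jb.1 \in points T, jb.1 != i & jb.2 == arm_sign jb.1]) acc.
have look acc j b : P acc -> lookup j acc = Some b -> b = arm_sign j.
  elim: acc => //= -[k c] acc IH /= /andP[/and3P[_ _ /eqP /= ->]] /IH h.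
  by case: eqP => [-> [<-]|_ /h].
(* After [rev], the label added most recently stands last; the default 0 is below every label of
   [points]. *)
suff gen acc : P acc -> path ltn (last 0 [seq jb.1 | jb <- rev acc]) js ->
    all (fun jb => jb.1 <= last 0 [seq jb.1 | jb <- rev acc]) acc ->
    (forall j, j \in js -> (j \in points T) && (j != i)) ->
    exists2 acc', acc' \in arms tb i js acc & P acc'.
  move=> js_s jsP; case: (gen [::]) => //; last by move=> acc a /look h; exists acc.
  case: js js_s jsP {gen} => //= j js -> /(_ j); rewrite inE eqxx mem_points => /(_ isT).
  by lia.
elim: js acc => [|k js IH] acc accP /=; first by exists acc => //; rewrite inE.
move=> /andP[lk pjs] le jsP.
have /andP[vk ki] := jsP k (mem_head _ _).
case: (IH ((k, arm_sign k) :: acc)).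
- by rewrite /= vk ki eqxx.
- by rewrite rev_cons map_rcons last_rcons.
- rewrite rev_cons map_rcons last_rcons /= leqnn /=.
  by apply: sub_all le => jb /leq_trans; apply; apply: ltnW.
- by move=> j jjs; apply: jsP; rewrite inE jjs orbT.
move=> acc' accin acc'P; exists acc' => //.
have c : all (fun jb => compatible tb i jb.1 k jb.2 (arm_sign k)) acc.
  apply/allP => jb jbacc.
  have /and3P[vj ji /eqP->] := allP accP _ jbacc.
  apply: compatible_sound => //; apply: leq_ltn_trans lk; exact: (allP le).
by rewrite mem_cat; move: c accin; case: (arm_sign k) => -> ->; rewrite ?orbT.
Qed.

Lemma extend_sound acc : 
  (forall j b, lookup j acc = Some b -> b = arm_sign j) ->
  sound f valid (extend tb i acc).
Proof.
move=> accP a b c v /andP[a0 ab] bc va vb vc.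
have F x y : x < y -> (y < x) = false by move=> xy; rewrite ltnNge ltnW.
have [ac ba cb ca] := And4 (ltn_trans ab bc) (F _ _ ab) (F _ _ bc) (F _ _ (ltn_trans ab bc)).
rewrite /extend; case: (eqVneq a 5) => [a5|na].
  subst a; case: (eqVneq b i) => [ei|nb].
    by move/accP => ->; rewrite /arm_sign -ei /sorted_sign ca ba bc.
  case: (eqVneq c i) => [ei|//] /accP->.
  by rewrite /arm_sign -ei /sorted_sign ba ca cb.
case: (eqVneq b 5) => [b5|nb].
  subst b; case: (eqVneq a i) => [ei|nai].
    by move/accP => ->; rewrite /arm_sign -ei /sorted_sign cb ab.
  case: (eqVneq c i) => [ei|//] /accP->.
  by rewrite /arm_sign -ei /sorted_sign ab ca cb.
case: (eqVneq c 5) => [c5|nc].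
  subst c; case: (eqVneq a i) => [ei|nai].
    by move/accP => ->; rewrite /arm_sign -ei /sorted_sign bc ab.
  case: (eqVneq b i) => [ei|//] /accP->.
  by rewrite /arm_sign -ei /sorted_sign ac ba bc.
move: va vb vc; rewrite /valid (negPf na) (negPf nb) (negPf nc) /= => va vb vc.
by move=> /tbP; apply=> //; rewrite a0.
Qed.
End Arms.

(** * From labels to point sets *)

Section Links.
Variables (R : realType) (n : nat) (p : 'I_n -> point R).
Hypothesis gp : general_position p.
Variables (i0 : 'I_n) (s : seq 'I_n).
Hypotheses (s_uniq : uniq s) (s_size : size s = n).
Hypothesis s_radial : forall j k, 0 < j < k -> k < n ->
  (cross (p (nth i0 s 0)) (p (nth i0 s j)) (p (nth i0 s k)) < 0)%R.
Variable e0 : segment n.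

Local Notation at_rank := (nth i0 s).
Local Notation pt r := (p (at_rank r)).

(** [e0] is a filler value, taken only when the two ranks do not name two distinct points. *)
Definition seg r1 r2 : segment n := insubd e0 [set at_rank r1; at_rank r2].

Lemma segC r1 r2 : seg r1 r2 = seg r2 r1.
Proof. by rewrite /seg setUC. Qed.

Lemma val_seg r1 r2 : r1 < n -> r2 < n -> r1 != r2 ->
  val (seg r1 r2) = [set at_rank r1; at_rank r2].
Proof.
by move=> h1 h2 h; rewrite insubdK // unfold_in cards2 nth_uniq ?s_size // h.
Qed.

Lemma seg_pointsE r1 r2 z : r1 < n -> r2 < n -> r1 != r2 ->
  seg_points p (seg r1 r2) z <-> on_closed_segment (pt r1) (pt r2) z.
Proof.
move=> h1 h2 h; rewrite /seg_points val_seg //; split; last first.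
  move=> zP; exists (at_rank r1), (at_rank r2).
  by split; rewrite ?inE ?eqxx ?orbT // nth_uniq ?s_size.
case=> i [j [+ + + zP]]; rewrite !inE => hi hj ij.
case/orP: hi ij zP => /eqP->; case/orP: hj => /eqP->; rewrite ?eqxx // => _.
case=> t [t0 [t1 ->]]; exists (1 - t)%R; split; first by lra.
by split; [lra|congr pair => /=; ring].
Qed.

Lemma adj_seg r1 r2 r3 r4 : r1 < n -> r2 < n -> r3 < n -> r4 < n ->
  r1 != r2 -> r3 != r4 ->
  D_adj p (seg r1 r2) (seg r3 r4) <->
  disjoint_segments (pt r1) (pt r2) (pt r3) (pt r4).
Proof.
move=> *; rewrite /D_adj /disjoint_segments; split=> H [z [z1 z2]]; apply: H; exists z.
  by rewrite !seg_pointsE.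
by rewrite -!seg_pointsE.
Qed.

Lemma adjC (x y : segment n) : D_adj p x y -> D_adj p y x.
Proof. by move=> H [z [z1 z2]]; apply: H; exists z. Qed.

Lemma segP (x : segment n) : exists r1 r2, [/\ r1 < r2, r2 < n & x = seg r1 r2].
Proof.
have/cards2P := valP x; case=> i [j] [ij xE].
have mem k : k \in s.
  have [||_ ->] := uniq_min_size s_uniq (s2 := enum 'I_n); last by rewrite mem_enum.
    by move=> u _; rewrite mem_enum.
  by rewrite size_enum_ord s_size.
have rk k : index k s < n.
  by apply: leq_trans (eq_leq s_size); rewrite index_mem.
have nk k : at_rank (index k s) = k by rewrite nth_index.
wlog ltij : i j ij xE / index i s < index j s => [W|].
  case: (ltngtP (index i s) (index j s)) => h; first exact: (W i j).
    by apply: (W j i) => //; [rewrite eq_sym|rewrite setUC].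
  by case/eqP: ij; rewrite -(nk i) h nk.
exists (index i s), (index j s); split=> //.
by apply: val_inj; rewrite val_seg ?nk // ltn_eqF.
Qed.

(** Stated for any increasing naming [phi], so as to serve the kept points, the kept points with one
    gap point added, and the ranks themselves. *)
Lemma radial_ranks (phi : nat -> nat) (valid : pred nat) : phi 0 = 0 ->
  (forall j k, valid j -> valid k -> j < k -> phi j < phi k) ->
  (forall j, valid j -> phi j < n) -> valid 0 ->
  radial (fun j => pt (phi j)) valid.
Proof.
move=> phi0 inc lt v0; split=> [j k /andP[j0 jk] vj vk|i j k /andP[_ ij] jk vi vj vk].
  rewrite phi0; apply: s_radial; last exact: lt.
  by rewrite inc // andbT -phi0 inc.
by apply: (cross_neq0 gp);
  rewrite nth_uniq ?s_size ?lt // ltn_eqF // inc // (ltn_trans ij).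
Qed.

Variable T : nat.
Hypotheses (T5 : 5 < T) (Tn : T <= n) (T8 : T = 8 \/ n = T).

(** Labels 6 to [T] name the last ranks, with [T] sent to [n - 1]; [l.-1] makes up for the skipped
    label 5. The gap consists of the ranks from 5 to [n - T + 4]. *)
Definition rank l := if l < 5 then l else l.-1 + (n - T).

Lemma rankP l : l \in labels T ->
  (l < 5 /\ rank l = l) \/ (5 < l <= T /\ rank l = l.-1 + (n - T)).
Proof.
rewrite mem_labels /rank => /orP[h|h]; [by left; rewrite h|right].
by rewrite h; case/andP: h => h5 _; rewrite ltnNge ltnW.
Qed.

Lemma rank_lt l : l \in labels T -> rank l < n.
Proof. by move=> /rankP; move: T5 Tn; clear; lia. Qed.

Lemma rank_mono l k : l \in labels T -> k \in labels T -> l < k -> rank l < rank k.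
Proof. by move=> /rankP + /rankP; clear; lia. Qed.

Definition edge_seg (e : edge) := seg (rank e.1) (rank e.2).

(** One direction is enough: a missed disjointness may lose a link but never creates a false one. *)
Definition represents tb (q : pattern) (x : segment n) : Prop :=
  forall e, e \in edges T -> avoids tb q e -> D_adj p x (edge_seg e).

Local Notation corner := (fun l => pt (rank l)).
Local Notation is_label := (fun l => l \in labels T).

Lemma radial_corner : radial corner is_label.
Proof.
apply: radial_ranks => //; [exact: rank_mono|exact: rank_lt].
Qed.

Variable tb : table.
Hypothesis tbP : sound corner is_label (get tb).

Lemma edge_rank e : e \in edges T ->
  [/\ rank e.1 < rank e.2, rank e.1 < n & rank e.2 < n].
Proof. by rewrite mem_edges => /and3P[h1 h2 h]; rewrite rank_mono ?rank_lt. Qed.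

Lemma apart_adj e f : e \in edges T -> f \in edges T -> apart (get tb) e f ->
  D_adj p (edge_seg e) (edge_seg f).
Proof.
move=> eT fT ef; have [[e1 e2 e3] [f1 f2 f3]] := (edge_rank eT, edge_rank fT).
apply/adj_seg => //; rewrite ?ltn_eqF //.
move: eT fT; rewrite !mem_edges => /and3P[? ? ?] /and3P[? ? ?].
exact: (apart_sound radial_corner tbP).
Qed.

Lemma meet_adj e f : e \in edges T -> f \in edges T -> meet (get tb) e f ->
  ~ D_adj p (edge_seg e) (edge_seg f).
Proof.
move=> eT fT ef; have [[e1 e2 e3] [f1 f2 f3]] := (edge_rank eT, edge_rank fT).
move/adj_seg => /(_ e2 e3 f2 f3); rewrite !ltn_eqF // => /(_ isT isT).
move: eT fT; rewrite !mem_edges => /and3P[? ? ?] /and3P[? ? ?].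
by apply; apply: (meet_sound radial_corner tbP).
Qed.

Lemma represents_arm r l : 5 <= r < n - T + 5 -> l \in labels T ->
  exists2 q, q \in rays T tb & represents tb q (seg (rank l) r).
Proof.
move=> /andP[r5 rn] lT.
have T8' : T = 8 by case: T8 rn => // nT; rewrite -nT subnn ltnNge r5.
(* The label 5 now names the given gap point [r], which keeps the naming increasing. *)
pose phi j := if j == 5 then r else rank j.
pose valid j := (j == 5) || (j \in labels T).
have phi_lab j : j \in labels T -> phi j = rank j.
  by move=> /labels_neq5 /negPf; rewrite /phi => ->.
have rltn : r < n by move: Tn rn T5; clear; lia.
have phi_rad : radial (fun j => pt (phi j)) valid.
  apply: radial_ranks => [||j|].
  - by rewrite phi_lab // mem_labels.
  - move=> j k; rewrite /valid; case: eqP => [->|_] /= vj; case: eqP => [->|_] /= vk //.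
    + rewrite (phi_lab _ vk) /phi eqxx; move: (rankP vk) rn; clear; lia.
    + rewrite (phi_lab _ vj) /phi eqxx; move: (rankP vj) r5; clear; lia.
    + by move=> jk; rewrite !phi_lab // rank_mono.
  - rewrite /valid; case: eqP => [->|_] /= vj; first by rewrite /phi eqxx.
    by rewrite phi_lab ?rank_lt.
  - by rewrite /valid mem_labels.
have phi_tb : sound (fun j => pt (phi j)) (fun l => l \in labels T) (get tb).
  move=> i j k v ij jk vi vj vk; rewrite /sign !phi_lab //; exact: tbP.
have arm_apart sg e : sound (fun j => pt (phi j)) valid sg -> e \in edges T ->
    apart sg (arm_edge l) e -> D_adj p (seg (rank l) r) (edge_seg e).
  move=> sgP eT ap; have [e1 e2 e3] := edge_rank eT.
  move: (eT); rewrite mem_edges => /and3P[h1 h2 h12].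
  have v5 : valid 5 by rewrite /valid eqxx.
  have [vl v1 v2] : [/\ valid l, valid e.1 & valid e.2] by rewrite /valid lT h1 h2 !orbT.
  have lr : rank l != r.
    move: (rankP lT) r5 rn; clear; lia.
  have l5 := labels_neq5 lT.
  move: ap; rewrite /arm_edge; case: ltnP => ll ap.
    apply/adj_seg; rewrite ?rank_lt // ?ltn_eqF //.
    have := apart_sound phi_rad sgP _ _ _ _ _ _ ap.
    by rewrite /= (phi_lab _ lT) (phi_lab _ h1) (phi_lab _ h2); apply; rewrite ?labels_neq5.
  rewrite segC; apply/adj_seg; rewrite ?rank_lt // ?[r == _]eq_sym // ?ltn_eqF //.
  have := apart_sound phi_rad sgP _ _ _ _ _ _ ap.
  rewrite /= (phi_lab _ lT) (phi_lab _ h1) (phi_lab _ h2); apply=> //.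
  by rewrite ltn_neqAle eq_sym l5.
have [l0|l0] := posnP l.
  exists (Arm 0 [::]); first by rewrite /rays T8' !inE eqxx orbT.
  move=> e eT; rewrite -l0 => ap.
  by apply: (arm_apart _ _ _ eT ap); apply: extend_sound.
have lP : l \in points T by rewrite mem_points lT.
case: (@arms_sound _ _ T tb phi_rad phi_tb l lT [seq j <- points T | j != l]) => //.
- by rewrite (sorted_filter ltn_trans) // /points T8'.
- by move=> j; rewrite mem_filter andbC.
move=> acc accin accP; exists (Arm l acc).
  rewrite /rays T8' eqxx !in_cons; do 2 (apply/orP; right).
  apply/flatten_mapP; exists l; first by rewrite -T8'.
  by apply/mapP; exists acc; rewrite // -T8'.
by move=> e eT ap; apply: (arm_apart _ _ _ eT ap); apply: extend_sound.
Qed.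

Lemma represents_far r1 r2 : 5 <= r1 -> r1 < r2 -> r2 < n - T + 5 ->
  exists2 q, q \in rays T tb & represents tb q (seg r1 r2).
Proof.
move=> r15 r12 r2n.
have T8' : T = 8.
  by case: T8 r2n => // nT; rewrite -nT subnn ltnNge (leq_trans r15 (ltnW r12)).
exists Far; first by rewrite /rays T8' !inE eqxx.
move=> e eT; have [e1 e2 e3] := edge_rank eT => /= av.
move: (eT); rewrite mem_edges => /and3P[h1 h2 h12].
have [n1 n2] : r1 < n /\ r2 < n by move: Tn r2n r12 T5; clear; lia.
have id_rad : radial (fun j => pt j) (fun j => j < n).
  by apply: radial_ranks => //; move: e2; case: (n).
apply: adjC; apply/adj_seg; rewrite ?ltn_eqF //.
(* Angles alone decide this case, so a table that knows no orientation suffices. *)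
apply: (@apart_sound _ _ _ id_rad (fun _ _ _ => None) _ (_, _) (_, _)) => //.
have side l : l \in labels T -> if l < 5 then rank l < r1 else r2 < rank l.
  by move=> /rankP; move: r15 r12 r2n; clear => *; case: ifP; lia.
have := side _ h1; have := side _ h2; move: av h12 => /=.
rewrite /apart /apart_lt; case: (e) {eT e1 e2 e3 h1 h2} => [a b] /= av ab.
case/or3P: av => [/eqP->|b5|a5].
- rewrite [rank 0]/rank /= (leq_trans (isT : 0 < 5) r15); case: ifP => _ h _; first by rewrite h.
  have r1b := ltn_trans r12 h.
  by rewrite [rank b < r1]ltnNge (ltnW r1b) (gtn_eqF r1b) h.
- by rewrite b5 (ltn_trans ab b5) => -> ->.
- rewrite [a < 5]ltnNge (ltnW a5) /= => _ h; have r1a := ltn_trans r12 h.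
  by rewrite [rank a < r1]ltnNge (ltnW r1a) r1a h.
Qed.

Lemma represents_seg e : e \in edges T -> represents tb (Seg e) (edge_seg e).
Proof. by move=> eT f fT; apply: apart_adj. Qed.

Lemma rank_cover r : r < n ->
  (exists2 l, l \in labels T & rank l = r) \/ 5 <= r < n - T + 5.
Proof.
move=> rn; case: (ltnP r 5) => r5; first by left; exists r; rewrite ?mem_labels /rank r5.
case: (ltnP r (n - T + 5)) => rT; [by right|left].
exists (r - (n - T)).+1.
  by rewrite mem_labels; move: Tn T5 rn rT; clear; lia.
rewrite /rank ltnNge; move: Tn T5 rn rT; clear => *.
by rewrite ifN; lia.
Qed.

Lemma represented (x : segment n) :
  (exists2 e, e \in edges T & x = edge_seg e) \/
  (exists2 q, q \in rays T tb & represents tb q x).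
Proof.
have [r1 [r2 [r12 r2n ->]]] := segP x.
have [[l1 l1T rl1]|r1P] := rank_cover (ltn_trans r12 r2n); last first.
  right; have [[l2 l2T <-]|/andP[_ r2P]] := rank_cover r2n.
    by rewrite segC; apply: represents_arm.
  by case/andP: r1P => r1P _; apply: represents_far.
rewrite -rl1 in r12 *.
have [[l2 l2T rl2]|r2P] := rank_cover r2n; last by right; apply: represents_arm.
rewrite -rl2 in r12 *; left; exists (l1, l2) => //.
rewrite mem_edges /= l1T l2T /= ltnNge leq_eqVlt; apply/negP => /orP[/eqP h|h].
  by rewrite h ltnn in r12.
by move: (rank_mono l2T l1T h); rewrite ltnNge ltnW.
Qed.

Variable W : seq edge.
Hypotheses (W_sub : all (mem (edges T)) W) (W_check : check T tb W).
Let Wset : {set segment n} := [set x in [seq edge_seg e | e <- W]].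

Lemma links_of_overlap q q' x y : represents tb q x -> represents tb q' y ->
  overlap (hits tb W q) (hits tb W q') ->
  exists2 w, w \in Wset & D_adj p x w /\ D_adj p w y.
Proof.
move=> qx q'y; rewrite /hits overlapP => /hasP[e eW /andP[h h']].
have eT := allP W_sub _ eW.
exists (edge_seg e); first by rewrite inE map_f.
by split; [apply: qx|apply/adjC/q'y].
Qed.


Lemma links x y : x \notin Wset -> y \notin Wset -> x != y ->
  [\/ D_adj p x y, exists2 w, w \in Wset & D_adj p x w /\ D_adj p w y |
    (forall z, ~ (D_adj p x z /\ D_adj p z y)) /\
    exists u v, [/\ u \in Wset, v \in Wset, D_adj p x u, D_adj p u v & D_adj p v y]].
Proof.
case/and3P: W_check => /allrelP SS /allrelP SR /allrelP RR.
have seg_in e : e \in edges T -> edge_seg e \notin Wset ->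
    (e, hits tb W (Seg e)) \in [seq (e, hits tb W (Seg e)) | e <- segs T W].
  move=> eT eW; apply: map_f; rewrite mem_filter eT andbT.
  by apply: contra eW => eW; rewrite inE map_f.
have ray_in q : q \in rays T tb ->
    (q, hits tb W q) \in [seq (p, hits tb W p) | p <- rays T tb].
  exact: (map_f (fun q => (q, hits tb W q))).
have hit_in q : q \in rays T tb ->
    hits tb W q \in undup (unzip2 [seq (p, hits tb W p) | p <- rays T tb]).
  by move=> qT; rewrite mem_undup; apply: (map_f snd (ray_in q qT)).
have SRP e q x' : e \in edges T -> edge_seg e \notin Wset -> q \in rays T tb ->
    represents tb q x' -> D_adj p (edge_seg e) x' \/
    exists2 w, w \in Wset & D_adj p (edge_seg e) w /\ D_adj p w x'.
  move=> eT eW qT qx; have := SR _ _ (seg_in e eT eW) (ray_in q qT) => /=.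
  case: ifP => [ov _|_ av]; last by left; apply/adjC/qx.
  by right; apply: links_of_overlap ov => //; apply: represents_seg.
have [[e eT ->]|[q qT qx]] := represented x; last first.
  have [[f fT ->] _ fW _|[q' qT' qy] _ _ _] := represented y.
    have [h|[w wW [h1 h2]]] := SRP f q x fT fW qT qx.
      by apply: Or31; apply: adjC.
    by apply: Or32; exists w => //; split; apply: adjC.
  (* Two distinct segments may have the same pattern; the check covers this because it also compares
     each hit list with itself. *)
  apply: Or32; apply: links_of_overlap qx qy _.
  by apply: RR; apply: hit_in.
have [[f fT ->]|[q qT qy]] := represented y; last first.
  move=> eW _ _; have [h|h] := SRP e q y eT eW qT qy; first exact: Or31.
  exact: Or32.
move=> eW fW ef; have := SS _ _ (seg_in e eT eW) (seg_in f fT fW) => /=.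
case: ifP => [ov _|_].
  by apply: Or32; apply: links_of_overlap ov; apply: represents_seg.
case: eqP => [E|_]; first by rewrite E eqxx in ef.
case: ifP => [ap _|_]; first by apply: Or31; apply: apart_adj.
case/and3P => nT8 /allP no /hasP[u uW /andP[eu /hasP[v vW /andP[uv vf]]]].
apply: Or33; split; last first.
  have [uT vT] := (allP W_sub _ uW, allP W_sub _ vW).
  by exists (edge_seg u), (edge_seg v); split; rewrite ?inE ?map_f //; apply: apart_adj.
(* Since [T] is not 8, [rays] is empty and every segment [z] joins kept points. *)
move=> z; have [[g gT ->]|[q]] := represented z; last by rewrite /rays (negPf nT8).
case/orP: (no g gT) => m [h1 h2]; first exact: (meet_adj eT gT m).
exact: (meet_adj fT gT m (adjC h2)).
Qed.

Lemma leq_mu_check : size W <= 9 -> 'C(n, 2) - 9 <= mu (@D_adj R n p).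
Proof.
move=> W9; apply: leq_trans (leq_mu_of_links links).
rewrite card_sig -[n in 'C(n, 2)]card_ord -(card_draws 'I_n 2) cardsE.
apply: leq_sub2l; apply: leq_trans W9; rewrite cardsE.
by apply: leq_trans (card_size _) _; rewrite size_map.
Qed.

End Links.

Lemma leq_mu_verify (R : realType) (n : nat) (p : 'I_n -> point R) T pool t :
  general_position p -> verify T pool t ->
  all (fun W => all (mem (edges T)) W && (size W <= 9)) pool ->
  5 < T -> T <= n -> T = 8 \/ n = T ->
  'C(n, 2) - 9 <= mu (@D_adj R n p).
Proof.
move=> gp ver poolP T5 Tn T8.
have n0 : 0 < n by apply: leq_trans Tn; apply: leq_trans T5.
have [s [s_uniq s_size s_radial]] := radial_order gp (Ordinal n0).
have n1 : 1 < n by apply: leq_trans Tn; apply: leq_trans T5.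
have e01 : #|[set Ordinal n0; Ordinal n1]| == 2 by rewrite cards2.
pose e0 : segment n := exist (fun e : {set 'I_n} => #|e| == 2) _ e01.
have [tb [w [tbP W_check]]] := verify_sound (radial_corner gp s_uniq s_size s_radial T5 Tn) ver.
have /andP[W_sub W9] : all (mem (edges T)) (nth [::] pool w) && (size (nth [::] pool w) <= 9).
  have [h|h] := ltnP w (size pool); first by rewrite (all_nthP [::] poolP).
  (* An index beyond the pool denotes the empty list, which satisfies both bounds. *)
  by rewrite nth_default.
exact: (leq_mu_check gp s_uniq s_size s_radial e0 T5 Tn T8 tbP W_sub W_check W9).
Qed.

(** * The case analysis *)

(** The candidates for [W] and the trees come from a computer search. *)
Definition pool6 : seq (seq edge) := [::
  [:: (0, 3); (0, 4); (0, 6); (1, 4); (1, 6); (2, 4); (2, 6); (3, 6); (4, 6)]].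

(** For six points one choice of [W] serves all orientations. *)
Definition tree6 : dtree :=
  Leaf 0.

Definition pool7 : seq (seq edge) := [::
  [:: (0, 1); (0, 7); (1, 2); (2, 3); (3, 4); (4, 6); (6, 7)];
  [:: (0, 2); (0, 3); (0, 4); (1, 4); (2, 3); (2, 4); (2, 6); (2, 7); (3, 4)];
  [:: (0, 3); (0, 4); (0, 6); (0, 7); (1, 7); (2, 7); (3, 7); (4, 7); (6, 7)];
  [:: (0, 1); (0, 2); (0, 3); (0, 4); (1, 2); (1, 3); (1, 4); (1, 6); (1, 7)];
  [:: (0, 3); (0, 4); (0, 6); (1, 6); (2, 6); (3, 4); (3, 6); (3, 7); (4, 6)];
  [:: (0, 1); (0, 2); (0, 3); (1, 2); (1, 3); (1, 4); (1, 6); (1, 7); (2, 7)];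
  [:: (0, 4); (0, 6); (0, 7); (1, 6); (1, 7); (2, 7); (3, 7); (4, 7); (6, 7)];
  [:: (0, 1); (0, 2); (0, 3); (0, 4); (0, 6); (0, 7); (1, 7); (2, 3); (2, 7)];
  [:: (0, 7); (1, 2); (1, 6); (1, 7); (2, 6); (2, 7); (3, 7); (4, 7); (6, 7)]].

Definition tree7 : dtree :=
  Node 3 6 7 (Node 1 3 6 (Node 2 3 6 (Node 3 4 6 (Node 1 2 3 (Node 4 6 7 (Node 2 3 4
  (Leaf 0) (Leaf 1)) (Leaf 2)) (Leaf 3)) (Node 1 4 7 (Node 2 4 7 (Leaf 4) (Leaf 3))
  (Node 1 2 6 (Leaf 2) (Leaf 3)))) (Node 3 4 6 (Leaf 5) (Leaf 6))) (Node 3 4 6 (Node 1 2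
  3 (Leaf 2) (Leaf 7)) (Node 2 3 6 (Leaf 3) (Leaf 2)))) (Leaf 8).

Definition pool8 : seq (seq edge) := [::
  [:: (0, 6); (0, 8); (1, 2); (1, 6); (1, 7); (2, 6); (2, 7); (3, 4); (6, 7)];
  [:: (0, 7); (0, 8); (1, 2); (1, 7); (1, 8); (2, 7); (2, 8); (6, 7); (7, 8)];
  [:: (0, 3); (0, 4); (0, 7); (0, 8); (1, 2); (1, 8); (2, 8); (3, 4); (7, 8)];
  [:: (0, 3); (0, 4); (0, 8); (1, 2); (2, 7); (3, 4); (3, 8); (4, 8); (6, 7)];
  [:: (0, 1); (0, 2); (0, 3); (0, 4); (1, 4); (1, 7); (1, 8); (2, 3); (7, 8)];
  [:: (0, 6); (0, 8); (1, 2); (1, 6); (1, 8); (2, 6); (2, 8); (3, 4); (6, 7)];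
  [:: (0, 2); (0, 3); (0, 8); (1, 4); (2, 3); (2, 8); (3, 4); (3, 8); (6, 7)];
  [:: (0, 1); (0, 3); (1, 3); (1, 7); (1, 8); (3, 4); (3, 7); (3, 8); (7, 8)];
  [:: (0, 7); (0, 8); (1, 2); (1, 7); (1, 8); (2, 7); (2, 8); (3, 4); (6, 7)];
  [:: (0, 2); (0, 4); (0, 8); (1, 4); (2, 3); (2, 4); (2, 8); (4, 8); (6, 7)];
  [:: (0, 1); (0, 2); (0, 4); (0, 8); (1, 3); (2, 4); (2, 8); (4, 8); (6, 7)];
  [:: (0, 3); (0, 6); (1, 2); (1, 7); (1, 8); (2, 7); (2, 8); (3, 4); (7, 8)];
  [:: (0, 1); (0, 2); (0, 4); (0, 6); (1, 3); (1, 7); (1, 8); (2, 4); (7, 8)];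
  [:: (0, 2); (0, 3); (0, 8); (1, 3); (2, 3); (2, 4); (2, 8); (3, 8); (6, 7)];
  [:: (0, 6); (0, 8); (1, 2); (1, 7); (2, 6); (2, 7); (2, 8); (3, 4); (6, 7)];
  [:: (0, 6); (1, 2); (2, 3); (2, 4); (2, 7); (2, 8); (3, 4); (3, 6); (7, 8)];
  [:: (0, 1); (0, 3); (0, 7); (0, 8); (1, 3); (1, 7); (2, 4); (2, 6); (6, 7)];
  [:: (0, 1); (2, 3); (2, 4); (2, 6); (2, 7); (2, 8); (3, 4); (4, 6); (7, 8)];
  [:: (0, 1); (0, 2); (1, 2); (1, 7); (1, 8); (2, 3); (2, 7); (2, 8); (7, 8)];
  [:: (0, 1); (0, 6); (0, 7); (1, 6); (1, 7); (2, 3); (6, 7); (6, 8); (7, 8)];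
  [:: (0, 1); (0, 3); (0, 4); (0, 8); (1, 3); (1, 8); (2, 4); (3, 7); (7, 8)];
  [:: (0, 1); (0, 6); (0, 7); (0, 8); (1, 6); (2, 3); (6, 7); (6, 8); (7, 8)];
  [:: (0, 1); (2, 3); (2, 4); (2, 7); (3, 4); (3, 7); (4, 7); (6, 8); (7, 8)];
  [:: (0, 7); (0, 8); (1, 2); (1, 7); (2, 4); (2, 7); (2, 8); (6, 7); (7, 8)];
  [:: (0, 3); (0, 8); (1, 2); (1, 7); (1, 8); (2, 7); (2, 8); (3, 4); (6, 7)];
  [:: (0, 3); (0, 8); (1, 2); (1, 8); (2, 3); (2, 8); (3, 4); (3, 8); (7, 8)];
  [:: (0, 4); (0, 6); (1, 2); (1, 7); (1, 8); (2, 7); (2, 8); (3, 4); (7, 8)];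
  [:: (0, 1); (0, 3); (0, 4); (1, 4); (1, 7); (1, 8); (2, 3); (4, 6); (7, 8)];
  [:: (0, 8); (1, 2); (1, 3); (2, 3); (2, 8); (3, 4); (3, 8); (4, 8); (6, 7)];
  [:: (0, 1); (0, 6); (1, 2); (1, 4); (1, 7); (1, 8); (2, 4); (4, 6); (7, 8)];
  [:: (0, 6); (0, 8); (1, 2); (1, 3); (1, 7); (2, 3); (2, 7); (4, 7); (6, 7)];
  [:: (0, 3); (0, 4); (0, 8); (1, 2); (2, 8); (3, 4); (3, 8); (4, 8); (6, 7)];
  [:: (0, 1); (1, 7); (2, 3); (3, 4); (3, 8); (4, 6); (6, 7); (6, 8); (7, 8)];
  [:: (0, 7); (0, 8); (1, 2); (1, 6); (2, 6); (2, 7); (2, 8); (3, 4); (6, 7)];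
  [:: (0, 7); (0, 8); (1, 2); (1, 3); (2, 3); (4, 6); (4, 7); (6, 7); (7, 8)];
  [:: (0, 1); (0, 2); (0, 3); (0, 4); (0, 8); (1, 4); (1, 8); (2, 3); (6, 7)];
  [:: (0, 1); (0, 2); (0, 3); (0, 8); (1, 4); (2, 3); (2, 8); (3, 8); (6, 7)];
  [:: (0, 3); (0, 4); (0, 8); (1, 2); (2, 6); (3, 4); (3, 8); (4, 8); (6, 7)];
  [:: (0, 1); (0, 4); (0, 8); (1, 3); (1, 8); (2, 4); (3, 6); (4, 8); (6, 7)];
  [:: (0, 1); (0, 2); (0, 3); (0, 4); (1, 3); (1, 7); (1, 8); (2, 4); (7, 8)];
  [:: (0, 6); (0, 8); (1, 2); (1, 3); (2, 3); (2, 6); (3, 6); (4, 7); (6, 8)];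
  [:: (0, 6); (0, 8); (1, 2); (1, 7); (2, 7); (3, 4); (3, 7); (4, 7); (6, 7)];
  [:: (0, 6); (0, 8); (1, 2); (1, 7); (2, 7); (3, 6); (4, 7); (6, 7); (7, 8)];
  [:: (0, 1); (0, 4); (1, 8); (2, 3); (2, 8); (3, 8); (4, 6); (6, 8); (7, 8)];
  [:: (0, 6); (0, 8); (1, 3); (1, 6); (2, 4); (2, 6); (3, 6); (4, 6); (6, 7)];
  [:: (0, 2); (0, 3); (0, 8); (1, 3); (2, 4); (3, 6); (3, 7); (3, 8); (6, 7)];
  [:: (0, 3); (0, 4); (0, 7); (0, 8); (1, 2); (1, 8); (3, 4); (3, 8); (6, 8)];
  [:: (0, 1); (0, 6); (1, 2); (1, 7); (1, 8); (2, 3); (2, 8); (3, 4); (7, 8)];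
  [:: (0, 3); (0, 4); (0, 8); (1, 2); (1, 4); (2, 3); (3, 4); (3, 8); (6, 7)];
  [:: (0, 1); (0, 3); (0, 7); (1, 7); (2, 3); (2, 7); (3, 7); (6, 7); (7, 8)]].

Definition tree8 : dtree :=
  Node 6 7 8 (Node 1 2 4 (Node 1 3 7 (Node 1 4 8 (Node 2 3 7 (Node 4 6 8 (Node 2 4 8
  (Node 3 6 8 (Leaf 0) (Node 1 2 3 (Node 2 4 6 (Node 1 6 7 (Leaf 3) (Node 2 4 7 (Leaf 3)
  (Leaf 32))) (Node 2 4 7 (Leaf 17) (Leaf 6))) (Node 1 2 6 (Node 1 2 7 (Leaf 13) (Leaf
  13)) (Leaf 0)))) (Node 1 2 3 (Node 1 3 6 (Leaf 6) (Leaf 6)) (Node 1 2 6 (Node 1 2 7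
  (Leaf 6) (Leaf 13)) (Node 3 6 8 (Leaf 16) (Leaf 16))))) (Node 2 3 4 (Node 2 4 6 (Node
  3 6 8 (Node 3 4 7 (Leaf 3) (Leaf 41)) (Leaf 26)) (Leaf 29)) (Node 2 6 7 (Node 3 6 8
  (Leaf 42) (Leaf 3)) (Node 2 7 8 (Node 1 6 8 (Leaf 31) (Leaf 15)) (Leaf 2))))) (Node 1
  4 6 (Node 2 4 7 (Node 3 6 8 (Node 2 3 6 (Leaf 3) (Node 3 4 6 (Leaf 10) (Leaf 17)))
  (Node 2 3 6 (Node 2 4 8 (Node 1 3 4 (Node 1 6 7 (Leaf 15) (Node 1 6 8 (Leaf 15) (Leaf
  15))) (Leaf 11)) (Leaf 46)) (Node 3 7 8 (Leaf 12) (Leaf 38)))) (Node 1 3 6 (Node 4 7 8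
  (Node 2 6 7 (Leaf 5) (Node 1 6 8 (Node 3 6 8 (Node 4 6 8 (Leaf 14) (Leaf 14)) (Node 1
  3 4 (Leaf 47) (Leaf 14))) (Leaf 14))) (Node 3 4 7 (Node 3 6 7 (Leaf 0) (Node 3 6 8
  (Leaf 0) (Leaf 29))) (Leaf 5))) (Leaf 10))) (Node 3 4 7 (Node 2 4 7 (Node 2 3 8 (Leaf
  0) (Leaf 44)) (Leaf 5)) (Node 1 3 6 (Leaf 6) (Leaf 6))))) (Node 4 7 8 (Node 1 4 6
  (Leaf 4) (Node 1 6 7 (Leaf 4) (Node 1 2 6 (Leaf 4) (Leaf 4)))) (Leaf 21))) (Node 1 4 7
  (Node 1 6 8 (Node 1 4 6 (Node 2 3 6 (Node 3 6 8 (Leaf 49) (Leaf 11)) (Leaf 10)) (Leaf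
  24)) (Node 1 4 8 (Node 2 3 6 (Leaf 11) (Leaf 12)) (Node 3 6 8 (Leaf 0) (Leaf 0))))
  (Node 2 3 7 (Node 1 3 8 (Node 3 4 8 (Node 1 2 6 (Leaf 43) (Leaf 0)) (Node 1 4 6 (Leaf
  20) (Node 1 3 6 (Leaf 20) (Leaf 20)))) (Node 1 2 6 (Leaf 4) (Leaf 4))) (Node 3 6 8
  (Node 4 6 8 (Leaf 5) (Leaf 5)) (Node 4 6 8 (Leaf 5) (Leaf 5)))))) (Node 1 2 8 (Node 2
  3 8 (Node 2 6 8 (Node 4 7 8 (Node 1 2 6 (Node 1 2 3 (Node 1 4 7 (Node 1 2 7 (Leaf 9)
  (Leaf 9)) (Node 4 6 8 (Leaf 0) (Leaf 0))) (Node 1 4 7 (Node 1 3 7 (Leaf 3) (Node 3 6 8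
  (Node 4 6 8 (Leaf 0) (Leaf 21)) (Leaf 30))) (Node 1 3 7 (Leaf 45) (Leaf 3)))) (Node 3
  6 8 (Node 4 6 8 (Leaf 0) (Leaf 0)) (Node 4 6 8 (Leaf 0) (Leaf 0)))) (Node 1 2 3 (Node
  1 2 6 (Node 1 2 7 (Leaf 9) (Leaf 0)) (Leaf 0)) (Node 1 3 6 (Node 1 3 7 (Leaf 3) (Leaf
  48)) (Leaf 0)))) (Node 2 3 4 (Node 1 3 4 (Leaf 26) (Node 3 7 8 (Leaf 30) (Leaf 2)))
  (Leaf 11))) (Node 1 2 7 (Node 1 6 8 (Node 1 2 6 (Leaf 9) (Leaf 27)) (Node 2 3 6 (Leaf
  11) (Leaf 12))) (Node 2 4 7 (Node 1 2 6 (Node 1 3 8 (Node 1 3 6 (Node 2 6 8 (Leaf 9)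
  (Leaf 12)) (Leaf 9)) (Node 1 6 8 (Leaf 7) (Leaf 12))) (Node 2 4 6 (Leaf 35) (Leaf
  24))) (Node 1 3 6 (Node 3 6 8 (Leaf 11) (Leaf 5)) (Leaf 25))))) (Node 1 2 3 (Node 3 7
  8 (Node 1 6 7 (Leaf 7) (Node 1 3 6 (Leaf 40) (Node 2 7 8 (Leaf 7) (Leaf 7)))) (Node 1
  3 6 (Leaf 21) (Leaf 7))) (Node 1 2 7 (Leaf 2) (Node 1 2 6 (Leaf 18) (Leaf 18))))))
  (Node 2 7 8 (Node 1 2 8 (Node 3 7 8 (Node 1 3 8 (Node 4 6 7 (Node 4 7 8 (Leaf 19)
  (Leaf 19)) (Leaf 19)) (Node 1 4 7 (Leaf 39) (Node 1 2 4 (Leaf 8) (Leaf 7)))) (Node 4 7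
  8 (Node 1 2 6 (Node 2 4 7 (Node 1 2 3 (Node 1 3 6 (Node 1 4 6 (Leaf 22) (Leaf 22))
  (Leaf 3)) (Leaf 13)) (Node 1 4 8 (Node 1 3 6 (Leaf 6) (Leaf 6)) (Leaf 4))) (Node 1 4 8
  (Node 2 4 6 (Node 1 4 6 (Leaf 3) (Leaf 16)) (Node 2 3 6 (Leaf 16) (Leaf 8))) (Leaf
  4))) (Node 1 3 6 (Node 1 4 6 (Leaf 37) (Node 2 4 6 (Leaf 2) (Leaf 2))) (Node 1 2 6
  (Leaf 2) (Node 2 3 6 (Node 2 4 6 (Leaf 2) (Leaf 2)) (Leaf 2)))))) (Node 1 2 4 (Node 2
  3 7 (Leaf 4) (Leaf 8)) (Node 1 2 3 (Leaf 7) (Leaf 18)))) (Node 1 7 8 (Node 2 4 7 (Node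
  2 3 7 (Node 1 3 6 (Node 1 4 6 (Leaf 2) (Leaf 2)) (Leaf 2)) (Node 1 4 6 (Node 3 4 6
  (Node 1 2 6 (Node 3 4 8 (Node 3 7 8 (Leaf 10) (Leaf 23)) (Leaf 23)) (Leaf 27)) (Node 3
  6 8 (Node 3 7 8 (Leaf 17) (Leaf 33)) (Leaf 3))) (Node 1 3 7 (Node 1 3 4 (Node 1 3 6
  (Leaf 28) (Leaf 28)) (Node 2 4 8 (Leaf 34) (Leaf 17))) (Leaf 7)))) (Node 1 3 6 (Node 3
  4 7 (Node 2 3 6 (Leaf 1) (Node 1 3 4 (Leaf 25) (Leaf 10))) (Node 1 2 6 (Node 2 6 7
  (Leaf 36) (Node 3 7 8 (Leaf 1) (Node 4 7 8 (Leaf 1) (Leaf 1)))) (Node 4 7 8 (Leaf 1)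
  (Leaf 1)))) (Node 1 4 6 (Leaf 10) (Node 1 2 6 (Node 3 7 8 (Node 4 7 8 (Leaf 8) (Leaf
  8)) (Node 4 7 8 (Leaf 8) (Leaf 8))) (Node 3 7 8 (Node 4 7 8 (Leaf 1) (Leaf 1)) (Node 4
  7 8 (Leaf 1) (Leaf 1))))))) (Node 3 7 8 (Node 4 7 8 (Leaf 1) (Leaf 1)) (Node 4 7 8
  (Leaf 1) (Leaf 1))))).

Lemma verify_tree6 : verify 6 pool6 tree6.
Proof. by vm_compute. Qed.

Lemma verify_tree7 : verify 7 pool7 tree7.
Proof. by vm_compute. Qed.

Lemma verify_tree8 : verify 8 pool8 tree8.
Proof. by vm_compute. Qed.

Theorem theorem2 (R : realType) (n : nat) (p : 'I_n -> point R) :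
  (5 <= n)%N -> general_position p ->
  ('C(n, 2) - 9 <= mu (@D_adj R n p))%N.
Proof.
move=> n5 gp; have [n8|n8] := leqP 8 n.
  exact: (leq_mu_verify gp verify_tree8 isT isT n8 (or_introl erefl)).
case: (ltngtP n 6) => [n6|n6|n6].
- have /eqP nE : n == 5 by rewrite eqn_leq n5 -ltnS n6.
  have e01 : #|[set ord0; ord_max : 'I_5]| == 2 by rewrite cards2.
  move: p gp; rewrite nE => p gp.
  pose e0 : segment 5 := exist (fun e : {set 'I_5} => #|e| == 2) _ e01.
  (* For [n = 5] the bound is 1, and a singleton is vacuously a mutual-visibility set. *)
  have := @leq_mu _ (D_adj p) [set e0]; rewrite cards1; apply=> x y.
  by rewrite !inE => /eqP-> /eqP->; rewrite eqxx.
- have nE : n = 7 by apply/eqP; rewrite eqn_leq -ltnS n8.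
  exact: (leq_mu_verify gp verify_tree7 isT isT (eq_leq (esym nE)) (or_intror nE)).
- exact: (leq_mu_verify gp verify_tree6 isT isT (eq_leq (esym n6)) (or_intror n6)).
Qed.
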